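(* Problem (DRC) of the context admits the following reformulation, in the sense that $x\in\{0,1\}^n$ is feasible for (DRC) if and only if there exist $\gamma,z$ such that $(x,\gamma,z)$ is feasible for the problem below (both problems have the same objective $c^\top x$): $$\begin{aligned}\min_{x,\gamma,z}\ & c^\top x\\ \text{s.t.}\ & \delta-\gamma\epsilon\le\frac1N\sum_{j\in[N]}z_j,\\ & -z_j-\gamma\ge\min\{Q_j(\mu,x),0\},\quad\forall\mu\in\mathcal{M},\ \forall j\in[N],\\ & x\in\{0,1\}^n,\ \gamma\in\mathbb{R}_+,\ z\in\mathbb{R}^N_-,\end{aligned}$$ where, for $\mu=(\mu_1,\mu_2)$, $$Q_j(\mu,x):=\sum_{i\in[I]}\mu_{1i}\left(x^\top\hat\xi^j_i-v_i+v_m\right)+\mathbf{1}^\top\mu_2-\bar f(1-v_m),$$ $$\mathcal{M}:=\{(\mu_1,\mu_2)\in\mathbb{R}^I_-\times\mathbb{R}^n_-:\ \mu_1^\top\mathbf{1}_{I\times n}+\mu_2^\top\le -c_p^\top\}.$$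
   Context: Notation: $[m]=\{1,\dots,m\}$; $\mathbb{R}_+$, $\mathbb{R}_-$ are the nonnegative and nonpositive reals; $\mathbf{1}$ is an all-ones vector and $\mathbf{1}_{I\times n}$ the $I\times n$ all-ones matrix. Data: positive integers $n,I,N$; a real $p\ge1$; $\delta>0$; $\epsilon\in(0,1)$; $c\in\mathbb{R}^n$; integers $v_i\ge1$, $i\in[I]$, with $v_m:=\max\{v_i:i\in[I]\}$; samples $\hat\xi^1,\dots,\hat\xi^N\in\{0,1\}^{I\times n}$. For $\xi\in\{0,1\}^{I\times n}$, $\xi_i\in\{0,1\}^n$ is its $i$-th row (as a column vector) and $\|\cdot\|_p$ is the entrywise $p$-norm. Let $\hat{\mathbb{P}}=\frac1N\sum_{j=1}^N\Delta_{\hat\xi^j}$ be the empirical distribution ($\Delta$ = Dirac measure), $d_W(\mathbb{P}_1,\mathbb{P}_2)=\inf_{\mathbb{Q}}\mathbb{E}_{\mathbb{Q}}[\|\tilde X_1-\tilde X_2\|_p]$ (infimum over joint distributions $\mathbb{Q}$ of $(\tilde X_1,\tilde X_2)$ with marginals $\mathbb{P}_1,\mathbb{P}_2$), and $\mathcal{P}$ the set of probability distributions $\mathbb{P}$ on $\{0,1\}^{I\times n}$ with $d_W(\mathbb{P},\hat{\mathbb{P}})\le\delta$. Problem (DRC) is $$\min_{x\in\{0,1\}^n}\ c^\top x\quad\text{s.t.}\quad \inf_{\mathbb{P}\in\mathcal{P}}\mathbb{P}\{x^\top\tilde\xi_i\ge v_i,\ \forall i\in[I]\}\ge 1-\epsilon,$$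 where $\tilde\xi$ has distribution $\mathbb{P}$. For $z\in\mathbb{Z}$, $\bar f(z):=z^{1/p}$ if $z\ge0$ and $\bar f(z):=z$ if $z\le-1$. The vector $c_p\in\mathbb{R}^n$ has entries $(c_p)_k:=\bar f(k+1-v_m)-\bar f(k-v_m)$, $k\in[n]$. *)

(* Defs.v *)
From HB Require Import structures.
From mathcomp Require Import all_boot all_order all_algebra.
From mathcomp Require Import all_classical all_reals all_analysis.

Set Implicit Arguments.
Unset Strict Implicit.
Unset Printing Implicit Defensive.

Import Order.TTheory GRing.Theory Num.Theory.
Import numFieldNormedType.Exports.

Local Open Scope classical_set_scope.
Local Open Scope ring_scope.

(* A point of {0,1}^{m x n} is a boolean matrix; the space is finite and carries
   its discrete sigma-algebra. *)
HB.instance Definition _ (m n : nat) :=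
  @isMeasurable.Build default_measure_display 'M[bool]_(m, n)
    discrete_measurable discrete_measurable0
    discrete_measurableC discrete_measurableU.

Record min_problem (R : realType) (V : Type) := MinProblem {
  objective : V -> R;
  feasible : set V
}.

Section Wasserstein.
Context (R : realType) (m n : nat).
Implicit Type p : R.

Definition real_mx (xi : 'M[bool]_(m, n)) : 'M[R]_(m, n) :=
  map_mx (fun b : bool => b%:R) xi.

Definition entry_norm p (A : 'M[R]_(m, n)) : R :=
  (\sum_i \sum_k `|A i k| `^ p) `^ p^-1.

Definition couplings (P1 P2 : {measure set 'M[bool]_(m, n) -> \bar R}) :
    set (probability ('M[bool]_(m, n) * 'M[bool]_(m, n))%type R) :=
  [set Q | forall A, measurable A ->
     pushforward Q fst A = P1 A /\ pushforward Q snd A = P2 A].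

Definition dW p (P1 P2 : {measure set 'M[bool]_(m, n) -> \bar R}) : \bar R :=
  ereal_inf [set 'E_Q[fun w => entry_norm p (real_mx w.1 - real_mx w.2)]%E
            | Q in couplings P1 P2].

End Wasserstein.

Section Empirical.
Local Open Scope ereal_scope.
Context (R : realType) (m n N : nat) (xihat : 'I_N -> 'M[bool]_(m, n)).

Definition empirical (A : set 'M[bool]_(m, n)) : \bar R :=
  (N%:R^-1)%:E * \sum_(j < N) \d_(xihat j) A.

Let empirical0 : empirical set0 = 0.
Proof. by rewrite /empirical big1 ?mule0// => j _; rewrite measure0. Qed.

Let empirical_ge0 A : 0 <= empirical A.
Proof. by rewrite mule_ge0 ?lee_fin ?invr_ge0// sume_ge0. Qed.

Let empirical_sigma_additive : semi_sigma_additive empirical.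
Proof.
move=> F mF tF mUF; rewrite [X in _ --> X](_ : _ =
    lim ((fun k => \sum_(0 <= i < k) empirical (F i)) @ \oo)).
  by apply: is_cvg_ereal_nneg_natsum => k _; exact: empirical_ge0.
rewrite nneseriesZl//; last by move=> i _; exact: sume_ge0.
congr (_ * _); rewrite nneseries_sum//; apply: eq_bigr => /= j _.
exact: measure_semi_bigcup.
Qed.

HB.instance Definition _ := isMeasure.Build _ _ _ empirical
  empirical0 empirical_ge0 empirical_sigma_additive.

End Empirical.

Section ChanceConstraint.
Context (R : realType) (I n N : nat) (p delta epsilon : R) (c : 'cV[R]_n).
Context (v : 'I_I -> nat) (xihat : 'I_N -> 'M[bool]_(I, n)).
Implicit Types (x : 'cV[bool]_n) (xi : 'M[bool]_(I, n)) (i : 'I_I) (j : 'I_N).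

Definition linear_cost x : R := \sum_(k < n) c k 0 * (x k 0)%:R.

(* x^T xi_i; a natural number, since x and xi are binary. *)
Definition xdot x xi i : nat := (\sum_(k < n) x k 0%R * xi i k)%N.

Definition ambiguity_set : set (probability 'M[bool]_(I, n) R) :=
  [set P | (dW p P (empirical R xihat) <= delta%:E)%E].

Definition safe_event x : set 'M[bool]_(I, n) :=
  [set xi | forall i, (v i <= xdot x xi i)%N].

Definition DRC : min_problem R 'cV[bool]_n := MinProblem linear_cost
  [set x | ((1 - epsilon)%:E <=
            ereal_inf [set P (safe_event x) | P in ambiguity_set])%E].

Definition vmax : nat := \max_(i < I) v i.

Definition fbar (z : int) : R := if 0 <= z then z%:~R `^ p^-1 else z%:~R.

(* The k-th entry of the vector, k = 1, ..., n, is stored at the ordinal k - 1. *)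
Definition c_p : 'cV[R]_n :=
  \col_k (fbar (k.+1%:Z + 1 - vmax%:Z) - fbar (k.+1%:Z - vmax%:Z)).

Definition dual_set : set ('cV[R]_I * 'cV[R]_n) :=
  [set mu : 'cV[R]_I * 'cV[R]_n | [/\ forall i, mu.1 i 0 <= 0,
                forall k, mu.2 k 0 <= 0 &
                forall k, (mu.1^T *m (const_mx 1 : 'M[R]_(I, n)) + mu.2^T) 0 k
                          <= (- c_p^T) 0 k]].

Definition Q j (mu : 'cV[R]_I * 'cV[R]_n) x : R :=
  \sum_(i < I) mu.1 i 0 * ((xdot x (xihat j) i)%:R - (v i)%:R + vmax%:R)
  + \sum_(k < n) mu.2 k 0 - fbar (1 - vmax%:Z).

Definition reformulation : min_problem R ('cV[bool]_n * R * 'cV[R]_N) :=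
  MinProblem (fun w => linear_cost w.1.1)
  [set w : 'cV[bool]_n * R * 'cV[R]_N | let: (x, gamma, z) := w in
     [/\ delta - gamma * epsilon <= N%:R^-1 * \sum_(j < N) z j 0,
         forall mu, dual_set mu -> forall j,
           - z j 0 - gamma >= Num.min (Q j mu x) 0,
         0 <= gamma &
         forall j, z j 0 <= 0]].

End ChanceConstraint.

(* Main.v *)
Require Import Defs.
From HB Require Import structures.
From mathcomp Require Import all_boot all_order all_algebra.
From mathcomp Require Import all_classical all_reals all_analysis.
From mathcomp Require Import measurable_realfun zify ring lra.

Import Order.TTheory GRing.Theory Num.Theory.
Local Open Scope ring_scope.

(** Fix a decision [x] and call a scenario unsafe when it violates some
  constraint.  Both problems turn out to say that one real inequality in an
  unknown [gamma >= 0] is solvable, namely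
    [delta <= gamma * epsilon + mean over j of min (r_j - gamma, 0)],
  where [r_j] is the distance from the [j]-th sample to the unsafe scenarios
  ([dual_feasible]).

  The distance.  On binary matrices the entrywise [p]-norm of a difference is
  the [p]-th root of the number of disagreeing entries.  Violating constraint
  [i] takes [x^T xi_i - v_i + 1] changes from 1 to 0 in row [i] (none if this
  number is negative), and these suffice because [v_i >= 1].  The distance is
  therefore the positive part of [fbar] at the minimum over [i] of
  [x^T xi_i - v_i + 1] ([radius_le_dist], [radius_attained]).

  From the chance constraint to the inequality.  If every unsafe [zeta] is at
  distance at least [r xi] from [xi], then
    [min (r xi, gamma) <= dist zeta xi + gamma * (1 if zeta is safe)].
  Integrating this against a coupling of [P] with the empirical distribution
  bounds the probability of the safe event from below
  ([ambiguity_safe_ge]).  Conversely, moving a fraction [q_j] of the mass of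
  sample [j] to a nearest unsafe scenario costs at most the mean of
  [q_j * r_j] and makes a mass equal to the mean of [q_j] unsafe
  ([ambiguity_transport]).  Either the
  inequality has a solution, or some fractional plan [q] fits the budget
  [delta] and makes more than [epsilon] unsafe; this is the duality of the
  fractional knapsack problem, in which [gamma] is a quantile of the
  distances ([knapsack_duality]).

  From the reformulation to the inequality.  The function [fbar] is concave on
  the integers, so its increments decrease and a sum of the first [s] of them
  is the value of a linear program that fills unit boxes under the constraint
  of total amount at most [s].  The set over which [mu] ranges is the feasible
  set of the dual program: the best [mu] makes [Q_j] equal to minus [fbar] at
  the minimum above ([dual_value_le], [dual_value_attained]).  Hence the
  constraints on [z_j] say exactly [z_j <= min (r_j - gamma, 0)]. *)

(** * Concavity of [fbar] on the integers *)

Section FbarConcavity.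
Context {R : realType} (p : R).

Definition increment (z : int) : R := fbar p (z + 1) - fbar p z.

Lemma sum_increment (z : int) (s : nat) :
  \sum_(k < s) increment (z + k%:Z) = fbar p (z + s%:Z) - fbar p z.
Proof.
elim: s => [|s ih]; first by rewrite big_ord0 addr0 subrr.
rewrite big_ord_recr/= ih /increment.
have -> : z + s.+1%:Z = z + s%:Z + 1 by lia.
by ring.
Qed.

Hypothesis p_ge1 : 1 <= p.

Let p_gt0 : 0 < p. Proof. exact: lt_le_trans p_ge1. Qed.

Lemma powR_inv0 : 0 `^ p^-1 = 0 :> R.
Proof. by rewrite powR0// invr_eq0 gt_eqF. Qed.

Lemma root_le {a b : R} : 0 <= a -> a <= b -> a `^ p^-1 <= b `^ p^-1.
Proof.
move=> a0 ab; apply: ge0_ler_powR; rewrite ?nnegrE ?invr_ge0 ?(ltW p_gt0)//.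
exact: le_trans ab.
Qed.

(** Convexity of the [p]-th power, read on the arguments [a `^ p^-1] and
  [b `^ p^-1], is midpoint concavity of the [p]-th root. *)
Lemma root_midpoint (a b : R) : 0 <= a -> 0 <= b ->
  2^-1 * a `^ p^-1 + 2^-1 * b `^ p^-1 <= (2^-1 * a + 2^-1 * b) `^ p^-1.
Proof.
move=> a0 b0.
have rootK (t : R) : 0 <= t -> (t `^ p^-1) `^ p = t.
  by move=> t0; rewrite -powRrM mulVf ?gt_eqF// powRr1.
have powK (t : R) : 0 <= t -> (t `^ p) `^ p^-1 = t.
  by move=> t0; rewrite -powRrM mulfV ?gt_eqF// powRr1.
set u := a `^ p^-1; set w := b `^ p^-1.
have u0 : 0 <= u by exact: powR_ge0.
have w0 : 0 <= w by exact: powR_ge0.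
have h0 : 0 <= 2^-1 * u + 2^-1 * w by rewrite addr_ge0// mulr_ge0// invr_ge0.
rewrite -[leLHS]powK//; apply: root_le; first exact: powR_ge0.
rewrite -(rootK a)// -(rootK b)// -/u -/w.
have half : 2^-1 = 1 - 2^-1 :> R by field.
rewrite {2 4}half.
by apply: (convex_powR p_ge1 (Itv01 _ _)) => //=;
  rewrite ?inE/= ?in_itv/= ?u0 ?w0// ?invr_ge0// invf_le1 ?ler1n.
Qed.

Lemma fbar_nat (k : nat) : fbar p k%:Z = k%:R `^ p^-1.
Proof. by []. Qed.

Lemma fbar_nonpos {z : int} : z <= 0 -> fbar p z = z%:~R.
Proof.
move=> z0; rewrite /fbar; case: ifP => // z0'.
have -> : z = 0 by lia.
exact: powR_inv0.
Qed.

Lemma increment_nonpos {z : int} : z <= 0 -> increment z = 1.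
Proof.
move=> z0; rewrite /increment (fbar_nonpos z0); have [->|zn0] := eqVneq z 0.
  by rewrite add0r fbar_nat powR1 subr0.
by rewrite fbar_nonpos ?intrD ?addrK// ; [ring | lia].
Qed.

(** Discrete concavity of [fbar].  The linear branch meets the root branch with
  equal slopes: the increments at [-1] and at [0] are both 1, since [0] and
  [1] are fixed by the root. *)
Lemma increment_step (z : int) : increment (z + 1) <= increment z.
Proof.
have [z0|z0] := leP z (-1); first by rewrite !increment_nonpos//; lia.
case: z z0 => // k _.
rewrite /increment -!PoszD !fbar_nat.
have := @root_midpoint k%:R (k + 1 + 1)%:R (ler0n _ _) (ler0n _ _).
have -> : 2^-1 * k%:R + 2^-1 * (k + 1 + 1)%:R = (k + 1)%:R :> R.
  by rewrite !natrD; field.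
by lra.
Qed.

Lemma increment_le {z w : int} : z <= w -> increment w <= increment z.
Proof.
move=> zw; have -> : w = z + `|w - z|%N by lia.
elim: `|w - z|%N => [|k ih]; first by rewrite addr0.
by apply: le_trans ih; rewrite -addn1 PoszD addrA; exact: increment_step.
Qed.

Lemma increment_ge0 (z : int) : 0 <= increment z.
Proof.
have [z0|z0] := leP z 0; first by rewrite increment_nonpos.
case: z z0 => // k _; rewrite /increment -PoszD !fbar_nat subr_ge0.
by apply: root_le; rewrite ?ler_nat ?leq_addr.
Qed.

End FbarConcavity.

(** * Duality for the inner linear program *)

Section LinearDuality.
Context {R : realType} {I n : nat} (p : R) (v : 'I_I -> nat).
Hypothesis p_ge1 : 1 <= p.
Implicit Types (s : 'I_I -> nat) (mu : 'cV[R]_I * 'cV[R]_n).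

(** The objective of the dual of: maximize [\sum_k c_k y_k] over
  [0 <= y_k <= 1] with [\sum_k y_k <= s_i] for all [i], up to sign. *)
Definition dual_value s mu : R :=
  \sum_(i < I) mu.1 i 0 * (s i)%:R + \sum_(k < n) mu.2 k 0.

Let base : int := 1 - (vmax v)%:Z.

Lemma c_pE (k : 'I_n) : c_p n p v k 0 = increment p (base + k%:Z).
Proof. by rewrite mxE /increment /base; congr (fbar _ _ - fbar _ _); lia. Qed.

Lemma dual_setE mu : dual_set p v mu <->
  [/\ forall i, mu.1 i 0 <= 0, forall k, mu.2 k 0 <= 0 &
      forall k, \sum_i mu.1 i 0 + mu.2 k 0 <= - increment p (base + k%:Z)].
Proof.
have E k : (mu.1^T *m (const_mx 1 : 'M[R]_(I, n)) + mu.2^T) 0 k =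
    \sum_i mu.1 i 0 + mu.2 k 0.
  by rewrite !mxE; congr (_ + _); apply: eq_bigr => i _; rewrite !mxE mulr1.
have F k : (- (c_p n p v)^T) 0 k = - increment p (base + k%:Z).
  by rewrite -c_pE mxE [X in - X]mxE.
split=> -[h1 h2 h3]; split=> // k.
- by rewrite -E -F; exact: h3.
- by rewrite E F; exact: h3.
Qed.

(** Weak duality against the primal solution that fills the first [s i0]
  boxes: dropping the nonpositive [mu.2 k] with [k >= s i0] and replacing every
  [s i] by the smallest one only increases the value. *)
Lemma dual_value_le s (i0 : 'I_I) mu :
  (forall i, s i0 <= s i)%N -> (s i0 <= n)%N -> dual_set p v mu ->
  dual_value s mu <= fbar p base - fbar p (base + (s i0)%:Z).
Proof.
move=> smin sn /dual_setE[mu1 mu2 muc].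
rewrite -opprB -(sum_increment p) -sumrN.
apply: (@le_trans _ _
  (\sum_(k < s i0) (\sum_i mu.1 i 0 + mu.2 (widen_ord sn k) 0))); last first.
  by apply: ler_sum => k _; exact: muc.
rewrite big_split/= sumr_const card_ord -mulr_natr mulr_suml; apply: lerD.
  by apply: ler_sum => i _; apply: ler_wnM2l; rewrite ?ler_nat.
rewrite (bigID (fun k : 'I_n => k < s i0)%N)/=.
rewrite big_ord_narrow gerDl; apply: sumr_le0 => k _; exact: mu2.
Qed.

(** Complementary slackness dictates the optimum: the tight constraint [i0] is
  priced at the last increment taken, and each box filled before it at the
  excess of its own increment over that price. *)
Lemma dual_value_attained s (i0 : 'I_I) : (s i0 <= n)%N ->
  exists2 mu, dual_set p v mu &
    dual_value s mu = fbar p base - fbar p (base + (s i0)%:Z).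
Proof.
(* When [s i0 = 0] no increment is taken; the one just before [base] then
   serves as price, since it dominates all the later ones. *)
move=> sn; pose lam := increment p (base + (s i0)%:Z - 1).
pose mu : 'cV[R]_I * 'cV[R]_n :=
  (\col_i (if i == i0 then - lam else 0),
   \col_k (if (k < s i0)%N then lam - increment p (base + k%:Z) else 0)).
have sum1 : \sum_i mu.1 i 0 = - lam.
  rewrite (bigD1 i0)//= mxE eqxx big1 ?addr0// => i /negPf ii0.
  by rewrite mxE ii0.
exists mu.
  apply/dual_setE; split=> [i|k|k]; rewrite ?sum1 ?mxE.
  - by case: ifP => // _; rewrite oppr_le0 increment_ge0.
  - by case: ifP => // ks; rewrite subr_le0; apply: increment_le => //; lia.
  - case: ltnP => ks; first by rewrite addKr.
    by rewrite addr0 lerN2; apply: increment_le => //; lia.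
rewrite -opprB -(sum_increment p) /dual_value.
rewrite (bigD1 i0)//= mxE eqxx big1 ?addr0; last first.
  by move=> i /negPf ii0; rewrite mxE ii0 mul0r.
under eq_bigr do rewrite mxE.
rewrite -big_mkcond/=.
rewrite -(big_ord_widen _ (fun k => lam - increment p (base + k%:Z)) sn).
by rewrite sumrB sumr_const card_ord mulr_natr mulNrn addKr.
Qed.

End LinearDuality.

(** * Distance to the unsafe scenarios *)

Section Distance.
Context {R : realType} {I n : nat} (p : R) (v : 'I_I -> nat).
Hypothesis p_ge1 : 1 <= p.
Implicit Types (x : 'cV[bool]_n) (xi zeta : 'M[bool]_(I, n)).

Definition hamming xi zeta : nat := \sum_i \sum_k (xi i k != zeta i k).

Lemma entry_norm_hamming xi zeta :
  entry_norm p (real_mx R xi - real_mx R zeta) = (hamming xi zeta)%:R `^ p^-1.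
Proof.
have p0 : p != 0 by rewrite gt_eqF// (lt_le_trans _ p_ge1).
rewrite /entry_norm /hamming natr_sum; congr (_ `^ _).
apply: eq_bigr => i _; rewrite natr_sum; apply: eq_bigr => k _.
rewrite !mxE; case: (xi i k); case: (zeta i k).
all: by rewrite ?subrr ?subr0 ?sub0r ?normrN ?normr1 ?normr0 ?powR1 ?powR0.
Qed.

Lemma xdot_le_n x xi i : (xdot x xi i <= n)%N.
Proof.
rewrite /xdot -[leqRHS]card_ord -sum1_card.
by apply: leq_sum => k _; case: (x k _); case: (xi i k).
Qed.

Lemma xdot_hamming x xi zeta i :
  (xdot x xi i <= xdot x zeta i + hamming zeta xi)%N.
Proof.
rewrite /hamming (bigD1 i)//= addnA; apply: leq_trans (leq_addr _ _).
rewrite /xdot -big_split/=; apply: leq_sum => k _.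
by case: (x k _); case: (xi i k); case: (zeta i k).
Qed.

Lemma xdot_flip x xi i h : (h <= xdot x xi i)%N ->
  exists2 zeta, (hamming zeta xi <= h)%N & (xdot x zeta i + h = xdot x xi i)%N.
Proof.
pose A := [set k | x k 0 && xi i k]%SET.
have -> : xdot x xi i = #|A|.
  rewrite -sum1_card big_mkcond; apply: eq_bigr => k _; rewrite inE.
  by case: (x k _); case: (xi i k).
case/card_geqP => F [F_uniq F_size FA].
have hE : h = (\sum_k (k \in F))%N.
  rewrite -F_size -(card_uniqP F_uniq) -sum1_card big_mkcond.
  by apply: eq_bigr => k _; case: ifP.
exists (\matrix_(i', k) (xi i' k && ~~ ((i' == i) && (k \in F)))).
  rewrite /hamming (bigD1 i)//= [X in (_ + X)%N]big1 ?addn0; last first.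
    by move=> i' /negPf ii'; apply: big1 => k _; rewrite mxE ii' andbT eqxx.
  rewrite [leqRHS]hE; apply: leq_sum => k _; rewrite mxE eqxx.
  by case: (xi i k); case: (k \in F).
rewrite [in LHS]hE -sum1_card [RHS]big_mkcond -big_split/=.
apply: eq_bigr => k _; rewrite !mxE inE eqxx/=.
have : k \in F -> x k 0 && xi i k by move/FA; rewrite inE.
by case: (k \in F); case: (x k _); case: (xi i k) => // /(_ isT).
Qed.

(** The shift by [vmax v] makes the subtraction exact, and the slack is then the
  number of increments between [fbar] at [1 - vmax v] and [fbar] at
  [x^T xi_i - v_i + 1]. *)
Definition slack x xi i : nat := (xdot x xi i + vmax v - v i)%N.

Lemma v_le_vmax i : (v i <= vmax v)%N.
Proof. exact: (@leq_bigmax _ v i). Qed.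

Context (i_any : 'I_I).

Definition tightest x xi : 'I_I := [arg min_(i < i_any) slack x xi i].

Lemma slack_tightest x xi i : (slack x xi (tightest x xi) <= slack x xi i)%N.
Proof. by rewrite /tightest; case: arg_minnP => // i0 _; exact. Qed.

(** A constraint of largest demand has slack [x^T xi_i], so the smallest slack
  does not exceed the number [n] of available increments. *)
Lemma slack_tightest_le_n x xi : (slack x xi (tightest x xi) <= n)%N.
Proof.
have [|im im_max] := bigop.eq_bigmax v; first by apply/card_gt0P; exists i_any.
apply: leq_trans (slack_tightest x xi im) _.
by rewrite /slack -im_max addnK; exact: xdot_le_n.
Qed.

(** By [radius_le_dist] and [radius_attained], this is the distance from [xi] to
  the scenarios that are unsafe for [x] as soon as every [v i] is positive. *)
Definition safety_radius x xi : R :=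
  Num.max (fbar p (1 - (vmax v)%:Z + (slack x xi (tightest x xi))%:Z)) 0.

Lemma radius_ge0 x xi : 0 <= safety_radius x xi.
Proof. by rewrite le_max lexx orbT. Qed.

(** The truncated subtraction takes over the role of the maximum with 0. *)
Lemma radiusE x xi (i := tightest x xi) :
  safety_radius x xi = ((xdot x xi i).+1 - v i)%:R `^ p^-1.
Proof.
rewrite /safety_radius -/i; set z := (X in fbar p X).
have zE : z = (xdot x xi i).+1%:Z - (v i)%:Z.
  by have := v_le_vmax i; rewrite /z /slack; lia.
have [z0|z0] := leP z 0.
  rewrite fbar_nonpos// (_ : (_ - _)%N = 0%N); last by lia.
  by rewrite powR_inv0//; apply/max_idPr; rewrite lerz0.
rewrite (_ : z = ((xdot x xi i).+1 - v i)%N); last by lia.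
by rewrite fbar_nat; apply/max_idPl; exact: powR_ge0.
Qed.

(** A changed entry lowers [x^T xi_i] by at most 1 for a single [i], and no
  constraint can be violated by fewer changes than the tightest one. *)
Lemma radius_le_dist x xi zeta : ~ safe_event v x zeta ->
  safety_radius x xi <= entry_norm p (real_mx R zeta - real_mx R xi).
Proof.
move=> /existsNP[i /negP]; rewrite -ltnNge => unsafe_i.
rewrite entry_norm_hamming radiusE.
apply: root_le => //; rewrite ler_nat.
have := slack_tightest x xi i; have := xdot_hamming x xi zeta i.
have := v_le_vmax i; have := v_le_vmax (tightest x xi).
rewrite /slack; lia.
Qed.

(** The changes are made in the row of the tightest constraint; since its demand
  is at least 1, that row has enough entries to switch off. *)
Lemma radius_attained x xi : (forall i, 1 <= v i)%N ->
  exists2 zeta, ~ safe_event v x zeta &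
    entry_norm p (real_mx R zeta - real_mx R xi) <= safety_radius x xi.
Proof.
move=> v_ge1; set i := tightest x xi; have := v_ge1 i => vi.
have [|zeta Hz xz] := @xdot_flip x xi i ((xdot x xi i).+1 - v i)%N.
  by lia.
exists zeta; first by move=> /(_ i); lia.
by rewrite entry_norm_hamming radiusE; apply: root_le; rewrite ?ler_nat.
Qed.

End Distance.

(** * Finite mixtures of point masses *)

Section FiniteMixtures.
Context {d : measure_display} {T : measurableType d} {R : realType}.
Context {K : finType} (w : K -> R) (y : K -> T).
Hypothesis w_ge0 : forall k, 0 <= w k.

(** A property rather than a construction, so that it applies to measures that
  are given otherwise: empirical distributions and marginals of couplings. *)
Definition mixes (mu : {measure set T -> \bar R}) : Prop :=
  forall A, measurable A -> mu A = (\sum_k (w k)%:E * \d_(y k) A)%E.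

(** Sums of measures are indexed by natural numbers; the elements of [K] are
  numbered by [enum_val], and the atoms beyond [#|K|] vanish. *)
Let atom (i : nat) : {measure set T -> \bar R} :=
  if insub i is Some k then
    mscale (NngNum (w_ge0 (enum_val (k : 'I_#|K|)))) \d_(y (enum_val k))
  else mzero.

Let atomE (k : 'I_#|K|) : atom k =
  mscale (NngNum (w_ge0 (enum_val k))) \d_(y (enum_val k)).
Proof. by rewrite /atom valK. Qed.

Let mixes_msum : mixes (msum atom #|K|).
Proof.
move=> A _; rewrite /msum (reindex _ (onW_bij _ (enum_val_bij K)))/=.
by apply: eq_bigr => k _; rewrite atomE.
Qed.

Lemma probability_mixture : \sum_k w k = 1 ->
  exists P : probability T R, mixes P.
Proof.
move=> w1.
have mass : msum atom #|K| setT = 1%E.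
  rewrite mixes_msum// -[RHS]/(1%:E) -w1 -sumEFin; apply: eq_bigr => k _.
  by rewrite diracT mule1.
pose P : probability T R := HB.pack (msum atom #|K|)
  (Measure_isProbability.Build _ _ _ (msum atom #|K|) mass).
by exists P; exact: mixes_msum.
Qed.

Lemma integral_mixture (mu : {measure set T -> \bar R}) (f : T -> R) :
  mixes mu -> (forall t, 0 <= f t) -> measurable_fun setT f ->
  (\int[mu]_t (f t)%:E)%E = (\sum_k w k * f (y k))%:E.
Proof.
move=> mix_mu f0 mf.
have mEf := (measurable_EFinP _ _).2 mf.
rewrite (eq_measure_integral (msum atom #|K|)); last first.
  by move=> A mA _; rewrite mix_mu// mixes_msum.
rewrite ge0_integral_measure_sum//; last by move=> t _; rewrite lee_fin.
rewrite -sumEFin (reindex _ (onW_bij _ (enum_val_bij K)))/=.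
apply: eq_bigr => k _.
rewrite atomE ge0_integral_mscale//; last by move=> t _; rewrite lee_fin.
by rewrite integral_dirac// diracT mul1e EFinM.
Qed.

End FiniteMixtures.

(** * Transport to and from the empirical distribution *)

Section TransportBounds.
Context {R : realType} {m n N : nat} (p : R) (xihat : 'I_N -> 'M[bool]_(m, n)).
Hypothesis N_gt0 : (0 < N)%N.
Local Notation M := 'M[bool]_(m, n).
Local Notation dist zeta xi := (entry_norm p (real_mx R zeta - real_mx R xi)).

(** The product sigma-algebra is generated by rectangles, but on a finite product
  of discrete spaces it is discrete as well. *)
Lemma measurable_binary_pairs (A : set (M * M)) : measurable A.
Proof.
apply: countable_measurable => [[a b]|]; last first.
  exact/finite_set_countable/finite_finset.
rewrite (_ : [set (a, b)] = [set a] `*` [set b])%classic.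
  exact: measurableX.
by apply/seteqP; split=> -[a' b'] /= [-> ->].
Qed.

Lemma measurable_fun_binary_pairs {d} {U : measurableType d} (f : M * M -> U) :
  measurable_fun setT f.
Proof. by move=> _ A _; exact: measurable_binary_pairs. Qed.

Lemma empirical_mixes : mixes (fun=> N%:R^-1) xihat (empirical R xihat).
Proof. by move=> A _; rewrite /= /empirical ge0_sume_distrr. Qed.

(** Integrates [min (r xi, gamma) <= dist zeta xi + gamma * \1_S zeta], which
  holds pointwise: by the first term on the right when [zeta] is outside [S], by
  the second one when it is inside. *)
Lemma coupling_cost_ge {P : probability M R} {S : set M} {r : M -> R}
    {gamma : R} {C : probability (M * M)%type R} :
    couplings P (empirical R xihat) C ->
    (forall xi, 0 <= r xi) -> 0 <= gamma ->
    (forall zeta xi, ~ S zeta -> r xi <= dist zeta xi) ->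
  ((N%:R^-1 * \sum_j Num.min (r (xihat j)) gamma)%:E <=
   'E_C[fun w => dist w.1 w.2] + gamma%:E * P S)%E.
Proof.
move=> coup r0 g0 far.
have dist0 w : 0 <= dist w.1 w.2 by exact: powR_ge0.
have min0 xi : 0 <= Num.min (r xi) gamma by rewrite le_min r0.
pose safe (w : M * M) : R := \1_S w.1.
have mf (f : M * M -> R) : measurable_fun setT (EFin \o f).
  exact: measurable_fun_binary_pairs.
have -> : P S = (\int[C]_w (safe w)%:E)%E.
  rewrite -(coup S I).1 /pushforward -[(fst @^-1` S)%classic]setIT.
  rewrite -integral_indic//.
  exact: measurable_binary_pairs.
rewrite -ge0_integralZl//; [|exact: mf|by move=> w _; rewrite lee_fin].
rewrite expectation.unlock -ge0_integralD//; last 4 first.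
- by move=> w _; rewrite lee_fin.
- exact: mf.
- by move=> w _; rewrite lee_fin mulr_ge0.
- exact: (mf (fun w => gamma * safe w)).
have -> : (N%:R^-1 * \sum_j Num.min (r (xihat j)) gamma)%:E =
    (\int[C]_w (Num.min (r w.2) gamma)%:E)%E.
  have msnd : measurable_fun setT (@snd M M).
    exact: measurable_fun_binary_pairs.
  pose snd_mfun : {mfun (M * M)%type >-> M} :=
    HB.pack (@snd M M) (isMeasurableFun.Build _ _ _ _ _ msnd).
  pose f xi := Num.min (r xi) gamma.
  rewrite mulr_sumr.
  rewrite -(@integral_mixture _ _ _ _ (fun=> N%:R^-1) xihat _
    (pushforward C snd_mfun) f)//.
  - by rewrite ge0_integral_pushforward// => xi _; rewrite lee_fin min0.
  - by move=> A mA; exact: etrans (coup A mA).2 (empirical_mixes A mA).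
apply: ge0_le_integral => //.
- by move=> w _; rewrite lee_fin.
- exact: mf.
- exact: (mf (fun w => dist w.1 w.2 + gamma * safe w)).
move=> w _; rewrite -EFinM -EFinD lee_fin /safe indicE.
have [|/negP] := boolP (w.1 \in S).
  by rewrite mulr1 ge_min lerDr dist0 orbT.
by rewrite inE => wS; rewrite mulr0 addr0 ge_min far.
Qed.

(** The bound is uniform in the coupling, so it survives the infimum that
  defines [dW]. *)
Lemma ambiguity_safe_ge {P : probability M R} {S : set M} {r : M -> R}
    {gamma delta : R} :
    ambiguity_set p delta xihat P ->
    (forall xi, 0 <= r xi) -> 0 <= gamma ->
    (forall zeta xi, ~ S zeta -> r xi <= dist zeta xi) ->
  N%:R^-1 * (\sum_j Num.min (r (xihat j)) gamma) - gamma * fine (P S) <= delta.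
Proof.
move=> ambP r0 g0 far; rewrite -lee_fin; apply: le_trans ambP.
apply/ereal_infP => _ [C coup <-].
have := coupling_cost_ge coup r0 g0 far.
rewrite -[P S]fineK ?fin_num_measure//.
by rewrite EFinB EFinM leeBlDr.
Qed.

Hypothesis p_ge1 : 1 <= p.

Lemma entry_norm_self (xi : M) : dist xi xi = 0.
Proof.
rewrite entry_norm_hamming// /hamming big1 ?powR_inv0// => i _.
by apply: big1 => k _; rewrite eqxx.
Qed.

(** The coupling carries the atom of [xihat j] to [zeta j] in proportion [q j] and
  leaves the rest in place at no cost; [P] is its first marginal. *)
Lemma ambiguity_transport (q : 'I_N -> R) (zeta : 'I_N -> M) (delta : R) :
    (forall j, 0 <= q j <= 1) ->
    N%:R^-1 * (\sum_j q j * dist (zeta j) (xihat j)) <= delta ->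
  exists2 P : probability M R, ambiguity_set p delta xihat P &
    forall S, (forall j, ~ S (zeta j)) ->
      (P S <= (1 - N%:R^-1 * \sum_j q j)%:E)%E.
Proof.
move=> q01 cost.
have Ninv0 : 0 <= N%:R^-1 :> R by rewrite invr_ge0.
have q0 j : 0 <= q j by case/andP: (q01 j).
have q1 j : 0 <= 1 - q j by case/andP: (q01 j); rewrite subr_ge0.
(* The boolean tells the moved part of a sample from the part left in place. *)
pose w (k : 'I_N * bool) := N%:R^-1 * (if k.2 then q k.1 else 1 - q k.1).
pose y (k : 'I_N * bool) := (if k.2 then zeta k.1 else xihat k.1, xihat k.1).
have w0 k : 0 <= w k by rewrite mulr_ge0//; case: k.2.
have sum_pairs (V : nmodType) (F : 'I_N * bool -> V) :
    \sum_k F k = \sum_j (F (j, true) + F (j, false)).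
  under [RHS]eq_bigr do rewrite -(big_bool _ (fun b => F (_, b))).
  by rewrite pair_bigA; apply: eq_bigr => -[].
have w1 : \sum_k w k = 1.
  rewrite sum_pairs/= /w/=; under eq_bigr do rewrite -mulrDr subrKC mulr1.
  by rewrite sumr_const card_ord -[LHS]mulr_natr mulVf// pnatr_eq0 -lt0n.
have [P mixP] := probability_mixture w (fst \o y) w0 w1.
have [C mixC] := probability_mixture w y w0 w1.
exists P.
  apply: (@le_trans _ _ 'E_C[fun w => dist w.1 w.2]%E).
    apply: ereal_inf_lbound; exists C => // A mA.
    rewrite /pushforward !mixC; [|exact: measurable_binary_pairs..].
    split; first by rewrite mixP//; apply: eq_bigr.
    rewrite sum_pairs empirical_mixes//; apply: eq_bigr => j _.
    rewrite !diracE/= -ge0_muleDl ?lee_fin// -EFinD /w/=.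
    by rewrite -mulrDr subrKC mulr1.
  rewrite expectation.unlock (integral_mixture w y w0 _ _ mixC)//; last 2 first.
  - by move=> ?; exact: powR_ge0.
  - exact: measurable_fun_binary_pairs.
  rewrite lee_fin; apply: le_trans cost; rewrite mulr_sumr sum_pairs.
  by apply: ler_sum => j _; rewrite /w/= entry_norm_self mulr0 addr0 mulrA.
move=> S unsafe; rewrite mixP// sum_pairs.
have <- : \sum_j w (j, false) = 1 - N%:R^-1 * \sum_j q j.
  by rewrite mulr_sumr -[X in X - _]w1 sum_pairs big_split/= addrAC subrr add0r.
rewrite -sumEFin; apply: lee_sum => j _.
rewrite !diracE/= memNset//= mule0 add0e.
by rewrite -[leRHS]mule1 lee_pmul// lee_fin ?ler01// lern1 leq_b1.
Qed.

End TransportBounds.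

(** * Duality for the fractional knapsack problem *)

Section FractionalKnapsack.
Context {R : realType} {N : nat} (d : 'I_N -> R) (epsilon : R).
Hypothesis N_gt0 : (0 < N)%N.
Hypothesis epsilon_lt1 : epsilon < 1.

Let below (t : R) : R := N%:R^-1 * \sum_j (d j < t)%R%:R.
Let upto (t : R) : R := N%:R^-1 * \sum_j (d j <= t)%R%:R.

Let mean_le (f g : 'I_N -> R) : (forall j, f j <= g j) ->
  N%:R^-1 * \sum_j f j <= N%:R^-1 * \sum_j g j.
Proof. by move=> fg; rewrite ler_wpM2l ?invr_ge0//; apply: ler_sum. Qed.

Let mean1 : N%:R^-1 * \sum_(j < N) 1 = 1 :> R.
Proof. by rewrite sumr_const card_ord mulVf// pnatr_eq0 -lt0n. Qed.

(** The smallest [d j0] for which more than a fraction [epsilon] of the values is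
  at most [d j0]; were more than [epsilon] strictly below, the largest of those
  would be a smaller candidate. *)
Lemma quantile : 0 <= epsilon ->
  exists j0, below (d j0) <= epsilon /\ epsilon < upto (d j0).
Proof.
move=> e0; pose top := [arg max_(j > Ordinal N_gt0) d j]%O.
have d_top j : d j <= d top.
  by rewrite /top; case: arg_maxP => // i _; exact.
have upto_top : epsilon < upto (d top).
  by rewrite /upto; under eq_bigr do rewrite d_top; rewrite mean1.
pose j0 := [arg min_(j < top | epsilon < upto (d j)) d j]%O.
have [upto_j0 j0_min] : epsilon < upto (d j0) /\
    forall j, epsilon < upto (d j) -> d j0 <= d j.
  by rewrite /j0; case: arg_minP.
exists j0; split=> //; rewrite leNgt; apply/negP => below_j0.
have [j1 j1_lt] : exists j, d j < d j0.
  apply: contrapT => /forallNP none; move: below_j0.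
  rewrite /below big1 ?mulr0 ?ltNge ?e0// => j _.
  by move/negP/negbTE: (none j) => ->.
pose j2 := [arg max_(j > j1 | d j < d j0) d j]%O.
have [j2_lt j2_max] : d j2 < d j0 /\ forall j, d j < d j0 -> d j <= d j2.
  by rewrite /j2; case: arg_maxP.
suff /j0_min : epsilon < upto (d j2) by rewrite leNgt j2_lt.
apply: lt_le_trans below_j0 _; apply: mean_le => j.
by case: ltP => [/j2_max->|_].
Qed.

(** The greedy plan takes everything below the quantile [gamma], nothing above,
  and a fraction [theta] of the ties.  It satisfies
  [q_j * (d_j - gamma) = min (d_j - gamma, 0)] for every [j], so its cost is
  [gamma] times its mass plus the mean of the right-hand sides.  Hence, if the
  inequality fails at the quantile, a mass slightly larger than [epsilon] is
  still affordable. *)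
Lemma knapsack_duality (delta : R) : 0 <= epsilon -> (forall j, 0 <= d j) ->
  (exists2 gamma, 0 <= gamma &
     delta <= gamma * epsilon + N%:R^-1 * \sum_j Num.min (d j - gamma) 0) \/
  (exists q : 'I_N -> R, [/\ forall j, 0 <= q j <= 1,
     N%:R^-1 * (\sum_j q j * d j) <= delta & epsilon < N%:R^-1 * \sum_j q j]).
Proof.
move=> e0 d0; have [j0 [below_le upto_gt]] := quantile e0.
set gamma := d j0 in below_le upto_gt; set L := below gamma in below_le.
set U := upto gamma in upto_gt.
have g0 : 0 <= gamma by exact: d0.
set g := N%:R^-1 * \sum_j Num.min (d j - gamma) 0.
have [le_dual|gap_gt0] := leP delta (gamma * epsilon + g).
  by left; exists gamma.
right; set gap := delta - (gamma * epsilon + g).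
have {}gap_gt0 : 0 < gap by rewrite subr_gt0.
(* [eta] is the mass in excess of [epsilon]: limited by the mass of the ties and
   by the budget; [gamma + 1] avoids a division by zero. *)
pose eta := Num.min (U - epsilon) (gap / (gamma + 1)).
have g1 : 0 < gamma + 1 by lra.
have eta_gt0 : 0 < eta by rewrite lt_min subr_gt0 upto_gt divr_gt0.
have eta_U : epsilon + eta <= U.
  have : eta <= U - epsilon by rewrite ge_min lexx.
  lra.
have eta_gap : gamma * eta <= gap.
  apply: (@le_trans _ _ ((gamma + 1) * eta)); first by rewrite ler_pM2r//; lra.
  by rewrite mulrC -ler_pdivlMr// ge_min lexx orbT.
pose theta := (epsilon + eta - L) / (U - L).
have UL : 0 < U - L by lra.
pose q j : R := if d j < gamma then 1 else if d j == gamma then theta else 0.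
have meanq : N%:R^-1 * \sum_j q j = epsilon + eta.
  transitivity (L + theta * (U - L)); last by rewrite divfK ?gt_eqF//; ring.
  rewrite /L /U /below /upto -mulrBr mulrCA -mulrDr; congr (_ * _).
  rewrite -sumrB mulr_sumr -big_split/=; apply: eq_bigr => j _.
  by rewrite /q; case: ltgtP => _ /=; ring.
exists q; split.
- move=> j; rewrite /q; case: ltgtP => _; rewrite ?lexx ?ler01//.
  by rewrite divr_ge0 ?ler_pdivrMr ?mul1r//; lra.
- suff -> : N%:R^-1 * (\sum_j q j * d j) = gamma * (epsilon + eta) + g.
    by move: eta_gap; rewrite /gap; lra.
  rewrite -meanq /g [gamma * _]mulrCA -mulrDr; congr (_ * _).
  rewrite mulr_sumr -big_split/=; apply: eq_bigr => j _.
  rewrite /q; case: ltgtP => dj.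
  + by rewrite (min_idPl _); [ring | lra].
  + by rewrite (min_idPr _); [ring | lra].
  + by rewrite dj subrr minxx; ring.
- by rewrite meanq; lra.
Qed.

End FractionalKnapsack.

(** * Equivalence of the two problems *)

Section Reformulation.
Context {R : realType} {n I N : nat}.
Context {p delta epsilon : R} {c : 'cV[R]_n} {v : 'I_I -> nat}.
Context {xihat : 'I_N -> 'M[bool]_(I, n)}.
Hypotheses (N_gt0 : (0 < N)%N) (p_ge1 : 1 <= p) (delta_gt0 : 0 < delta).
Hypotheses (epsilon_gt0 : 0 < epsilon) (epsilon_lt1 : epsilon < 1).
Hypothesis v_ge1 : forall i, (1 <= v i)%N.
Context (i_any : 'I_I).
Implicit Type x : 'cV[bool]_n.

Local Notation r x j := (@safety_radius R I n p v i_any x (xihat j)).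

(** The least cost of making a fraction [epsilon] of the mass unsafe is at least
  [delta], as certified by a multiplier [gamma] of the mass constraint. *)
Definition dual_feasible x (gamma : R) : Prop := 0 <= gamma /\
  delta <= gamma * epsilon + N%:R^-1 * \sum_j Num.min (r x j - gamma) 0.

(** Positivity of [delta] excludes [gamma = 0], which allows dividing by [gamma]
  in the bound on the safe probability. *)
Lemma DRC_feasibleP x :
  feasible (DRC p delta epsilon c v xihat) x <->
  exists gamma, dual_feasible x gamma.
Proof.
split=> [/ereal_infP robust|[gamma [g0 dual]]].
  have [[gamma g0 dual]|[q [q01 cost mass]]] :=
    knapsack_duality (fun j => r x j) epsilon N_gt0 epsilon_lt1 delta
      (ltW epsilon_gt0) (fun j => radius_ge0 _ _ _ _ _).
    by exists gamma.
  exfalso.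
  have /choice[zeta zetaP] j : exists zeta, ~ safe_event v x zeta /\
      entry_norm p (real_mx R zeta - real_mx R (xihat j)) <= r x j.
    have [zeta] := radius_attained p v p_ge1 i_any x (xihat j) v_ge1.
    by exists zeta.
  have [|P ambP safe_le] :=
    ambiguity_transport p xihat N_gt0 p_ge1 q zeta delta q01.
    apply: le_trans cost; rewrite ler_wpM2l ?invr_ge0//; apply: ler_sum => j _.
    by rewrite ler_wpM2l ?(zetaP j).2//; case/andP: (q01 j).
  have := le_trans (robust _ (ex_intro2 _ _ P ambP erefl))
                   (safe_le _ (fun j => (zetaP j).1)).
  by rewrite lee_fin; lra.
apply/ereal_infP => _ [P ambP <-].
have far zeta xi : ~ safe_event v x zeta ->
    safety_radius p v i_any x xi <=
    entry_norm p (real_mx R zeta - real_mx R xi).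
  by move=> unsafe; apply: radius_le_dist.
have transport :=
  ambiguity_safe_ge p xihat ambP (radius_ge0 p v i_any x) g0 far.
rewrite -[P (safe_event v x)]fineK ?fin_num_measure// lee_fin.
have shift : N%:R^-1 * \sum_j Num.min (r x j - gamma) 0 =
    N%:R^-1 * (\sum_j Num.min (r x j) gamma) - gamma.
  have gammaE : gamma = N%:R^-1 * \sum_(j < N) gamma.
    rewrite sumr_const card_ord -[gamma *+ N]mulr_natl mulKf//.
    by rewrite pnatr_eq0 -lt0n.
  rewrite [X in _ - X]gammaE -mulrBr -sumrB; congr (_ * _).
  by apply: eq_bigr => j _; rewrite -[X in Num.min _ X](subrr gamma) addr_minl.
move: dual; rewrite shift => dual.
have gamma_gt0 : 0 < gamma.
  rewrite lt_neqAle g0 andbT; apply/eqP => gamma0; move: dual.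
  rewrite -gamma0 mul0r add0r subr0 big1 ?mulr0.
    by rewrite leNgt delta_gt0.
  by move=> j _; apply/min_idPr; exact: radius_ge0.
by rewrite -(ler_pM2l gamma_gt0); lra.
Qed.

Lemma Q_dual_value x j (mu : 'cV[R]_I * 'cV[R]_n) :
  Q p v xihat j mu x =
    dual_value (slack v x (xihat j)) mu - fbar p (1 - (vmax v)%:Z).
Proof.
rewrite /Q /dual_value; congr (_ + _ - _); apply: eq_bigr => i _.
rewrite /slack natrB ?natrD; first by rewrite addrAC.
exact: leq_trans (v_le_vmax v i) (leq_addl _ _).
Qed.

(** Only the best dual solution matters for the constraint on [z_j], and
  [Num.min (- f) 0] is minus the maximum of [f] and 0; the largest admissible
  [z_j] is therefore [Num.min (r_j - gamma) 0]. *)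
Lemma reformulation_feasibleP x :
  (exists gamma z,
     feasible (reformulation p delta epsilon c v xihat) (x, gamma, z))
  <-> exists gamma, dual_feasible x gamma.
Proof.
split=> [[gamma [z [budget zQ g0 z0]]]|[gamma [g0 dual]]].
  exists gamma; split=> //; rewrite -lerBlDl; apply: le_trans budget _.
  rewrite ler_wpM2l ?invr_ge0//; apply: ler_sum => j _; rewrite le_min z0 andbT.
  have [mu muM mu_val] := dual_value_attained p v p_ge1 (slack v x (xihat j))
    (tightest v i_any x (xihat j)) (slack_tightest_le_n v i_any x (xihat j)).
  have := zQ mu muM j; rewrite Q_dual_value mu_val addrAC subrr add0r.
  rewrite -oppr0 -oppr_max -/(r x j); lra.
exists gamma, (\col_j Num.min (r x j - gamma) 0); split=> //.
- by under eq_bigr do rewrite mxE; rewrite lerBlDl.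
- move=> mu muM j; rewrite mxE Q_dual_value.
  apply: (@le_trans _ _ (- r x j)).
    rewrite /safety_radius oppr_max oppr0 le_min !ge_min lexx orbT andbT.
    have := dual_value_le p v p_ge1 (slack v x (xihat j)) _ mu
      (slack_tightest v i_any x (xihat j))
      (slack_tightest_le_n v i_any x (xihat j)) muM.
    by move=> H; apply/orP; left; lra.
  have : Num.min (r x j - gamma) 0 <= r x j - gamma by rewrite ge_min lexx.
  lra.
- by move=> j; rewrite mxE ge_min lexx orbT.
Qed.

End Reformulation.

Theorem proposition6 (R : realType) (n I N : nat)
    (n_gt0 : (0 < n)%N) (I_gt0 : (0 < I)%N) (N_gt0 : (0 < N)%N)
    (p delta epsilon : R) (p_ge1 : 1 <= p) (delta_gt0 : 0 < delta)
    (epsilon_gt0 : 0 < epsilon) (epsilon_lt1 : epsilon < 1)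
    (c : 'cV[R]_n) (v : 'I_I -> nat) (v_ge1 : forall i, (1 <= v i)%N)
    (xihat : 'I_N -> 'M[bool]_(I, n)) :
  let drc := DRC p delta epsilon c v xihat in
  let ref := reformulation p delta epsilon c v xihat in
  (forall x : 'cV[bool]_n,
     feasible drc x <->
     exists (gamma : R) (z : 'cV[R]_N), feasible ref (x, gamma, z)) /\
  (forall (x : 'cV[bool]_n) (gamma : R) (z : 'cV[R]_N),
     objective ref (x, gamma, z) = objective drc x).
Proof.
move=> drc ref; split=> // x; rewrite /drc /ref.
apply: iff_trans (iff_sym (reformulation_feasibleP p_ge1 (Ordinal I_gt0) x)).
exact: DRC_feasibleP.
Qed.
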